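(* Let $(A,\ast,\alpha)$ be a Hom-alternative algebra and $\mathcal R:A\to A$ a Rota-Baxter operator of weight $0$ on it (so $\mathcal R\alpha=\alpha\mathcal R$ and $\mathcal R(x)\ast\mathcal R(y)=\mathcal R(\mathcal R(x)\ast y+x\ast\mathcal R(y))$). Let $x\prec y=x\ast\mathcal R(y)$ and $x\succ y=\mathcal R(x)\ast y$, so that $(A,\prec,\succ,\alpha)$ is a Hom-pre-alternative algebra, and let $(A,\cdot,\alpha)$ be the Hom-pre-Malcev algebra with $x\cdot y=x\succ y-y\prec x$. Let $(V,L_\prec,R_\prec,L_\succ,R_\succ,\beta)$ be a bimodule of $(A,\prec,\succ,\alpha)$ and $T:V\to A$ an $\mathcal O$-operator of $(A,\prec,\succ,\alpha)$ associated to it. Then: (1) $(V,L_\succ-R_\prec,R_\succ-L_\prec,\beta)$ is a bimodule of the Hom-pre-Malcev algebra $(A,\cdot,\alpha)$ (with $\ell=L_\succ-R_\prec$ and $r=R_\succ-L_\prec$); (2) $T$ is an $\mathcal O$-operator of $(A,\cdot,\alpha)$ with respect to $(V,L_\succ-R_\prec,R_\succ-L_\prec,\beta)$; (3) if $(V,\blacktriangleright,\blacktriangleleft,\beta)$ is the Hom-M-dendriform algebra associated to $(A,\cdot,\alpha)$, the bimodule in (1) and $T$, i.e. $a\blacktriangleright b=(R_\succ-L_\prec)(T(b))a$ and $a\blacktriangleleft b=(L_\succ-R_\prec)(T(a))b$, then for all $a,b\in V$ $$a\blacktriangleright b=a\nearrow b-b\swarrow a,\qquad a\blacktriangleleft b=a\searrow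 b-b\nwarrow a,$$ where $a\searrow b=L_\succ(T(a))b$, $a\nearrow b=R_\succ(T(b))a$, $a\swarrow b=L_\prec(T(a))b$, $a\nwarrow b=R_\prec(T(b))a$.
   Context: All vector spaces are over a field $\mathbb K$ of characteristic $0$. A Hom-algebra is a vector space with a bilinear product (or several) and a linear twisting map; all are assumed multiplicative, i.e. the twisting map is an endomorphism of each product. A Hom-alternative algebra is a Hom-algebra $(A,\ast,\alpha)$ with $as_\alpha(x,x,y)=as_\alpha(y,x,x)=0$, where $as_\alpha(x,y,z)=(x\ast y)\ast\alpha(z)-\alpha(x)\ast(y\ast z)$. A Hom-pre-alternative algebra $(A,\prec,\succ,\alpha)$ is a vector space with bilinear products $\prec,\succ$ and a linear map $\alpha$ such that, with $x\star y=x\prec y+x\succ y$: $(x\succ y)\prec\alpha(z)-\alpha(x)\succ(y\prec z)+(y\prec x)\prec\alpha(z)-\alpha(y)\prec(x\star z)=0$; $(x\succ y)\prec\alpha(z)-\alpha(x)\succ(y\prec z)+(x\star z)\succ\alpha(y)-\alpha(x)\succ(z\succ y)=0$; $(x\star y)\succ\alpha(z)-\alpha(x)\succ(y\succ z)+(y\star x)\succ\alpha(z)-\alpha(y)\succ(x\succ z)=0$; $(x\prec y)\prec\alpha(z)-\alpha(x)\prec(y\star z)+(x\prec z)\prec\alpha(y)-\alpha(x)\prec(z\star y)=0$. A bimodule $(V,L_\prec,R_\prec,L_\succ,R_\succ,\beta)$ of a Hom-pre-alternative algebra $(A,\prec,\succ,\alpha)$ consists of a vector space $V$, $\beta\in\mathrm{End}(V)$,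 and linear maps $L_\prec,R_\prec,L_\succ,R_\succ:A\to\mathrm{End}(V)$ with $\beta F(x)=F(\alpha(x))\beta$ for each $F\in\{L_\prec,R_\prec,L_\succ,R_\succ\}$ and, with $L=L_\prec+L_\succ$, $R=R_\prec+R_\succ$, for all $x,y\in A$: 1. $L_\succ(x\star y+y\star x)\beta=L_\succ(\alpha(x))L_\succ(y)+L_\succ(\alpha(y))L_\succ(x)$; 2. $R_\succ(\alpha(y))(L(x)+R(x))=L_\succ(\alpha(x))R_\succ(y)+R_\succ(x\succ y)\beta$; 3. $R_\prec(\alpha(y))L_\succ(x)+R_\prec(\alpha(y))R_\prec(x)=L_\succ(\alpha(x))R_\prec(y)+R_\prec(x\star y)\beta$; 4. $R_\prec(\alpha(y))R_\succ(x)+R_\prec(\alpha(y))L_\prec(x)=L_\prec(\alpha(x))R(y)+R_\succ(x\prec y)\beta$; 5. $L_\prec(y\prec x)\beta+L_\prec(x\succ y)\beta=L_\prec(\alpha(y))L(x)+L_\succ(\alpha(x))L_\prec(y)$; 6. $R_\prec(\alpha(x))L_\succ(y)+L_\succ(y\star x)\beta=L_\succ(\alpha(y))R_\prec(x)+L_\succ(\alpha(y))L_\succ(x)$; 7. $R_\prec(\alpha(x))R_\succ(y)+R_\succ(\alpha(y))R(x)=R_\succ(y\prec x)\beta+R_\succ(x\succ y)\beta$; 8. $L_\prec(y\succ x)\beta+R_\succ(\alpha(x))L(y)=L_\succ(\alpha(y))L_\prec(x)+L_\succ(\alpha(y))R_\succ(x)$; 9. $R_\prec(\alpha(x))R_\prec(y)+R_\prec(\alpha(y))R_\prec(x)=R_\prec(x\star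 y+y\star x)\beta$; 10. $R_\prec(\alpha(y))L_\prec(x)+L_\prec(x\prec y)\beta=L_\prec(\alpha(x))(R(y)+L(y))$. Equivalently, $A\oplus V$ with $(x+a)\ll(y+b)=x\prec y+L_\prec(x)b+R_\prec(y)a$, $(x+a)\gg(y+b)=x\succ y+L_\succ(x)b+R_\succ(y)a$ and twisting map $\alpha+\beta$ is a Hom-pre-alternative algebra. An $\mathcal O$-operator of $(A,\prec,\succ,\alpha)$ associated to this bimodule is a linear $T:V\to A$ with $T\circ\beta=\alpha\circ T$, $T(a)\succ T(b)=T(L_\succ(T(a))b+R_\succ(T(b))a)$, $T(a)\prec T(b)=T(L_\prec(T(a))b+R_\prec(T(b))a)$. A Hom-pre-Malcev algebra is a Hom-algebra $(A,\cdot,\alpha)$ such that, with $[x,y]=x\cdot y-y\cdot x$: $$[\alpha(y),\alpha(z)]\cdot\alpha(x\cdot t)+[[x,y],\alpha(z)]\cdot\alpha^2(t)+\alpha^2(y)\cdot([x,z]\cdot\alpha(t))-\alpha^2(x)\cdot(\alpha(y)\cdot(z\cdot t))+\alpha^2(z)\cdot(\alpha(x)\cdot(y\cdot t))=0.$$ A bimodule of a Hom-pre-Malcev algebra $(A,\cdot,\alpha)$ is $(V,\ell,r,\beta)$ with $\ell,r:A\to\mathrm{End}(V)$ linear, $\beta\in\mathrm{End}(V)$, such that, with $\rho=\ell-r$: (B1) $\beta\ell(x)=\ell(\alpha(x))\beta$, $\beta r(x)=r(\alpha(x))\beta$; (B2) $r(\alpha^2(x))\rho(\alpha(y))\rho(z)-r(\alpha(z)\cdot(y\cdot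 x))\beta^2+\ell(\alpha^2(y))r(z\cdot x)\beta+\ell(\alpha([z,y]))r(\alpha(x))\beta-\ell(\alpha^2(z))r(\alpha(x))\rho(y)=0$; (B3) $\ell(\alpha^2(y))\ell(\alpha(z))r(x)-r(\alpha^2(x))\rho(\alpha(y))\rho(z)-\ell(\alpha^2(z))r(y\cdot x)\beta-r(\alpha(z\cdot x))\rho(\alpha(y))\beta+r([z,y]\cdot\alpha(x))\beta^2=0$; (B4) $r(\alpha(y)\cdot(z\cdot x))\beta^2+r(\alpha^2(x))\rho([y,z])\beta-\ell(\alpha^2(y))\ell(\alpha(z))r(x)+r(\alpha(y\cdot x))\rho(\alpha(z))\beta+\ell(\alpha^2(z))r(\alpha(x))\rho(y)=0$; (B5) $\ell([[x,y],\alpha(z)])\beta^2-\ell(\alpha^2(x))\ell(\alpha(y))\ell(z)+\ell(\alpha^2(z))\ell(\alpha(x))\ell(y)+\ell(\alpha([y,z]))\ell(\alpha(x))\beta+\ell(\alpha^2(y))\ell([x,z])\beta=0$. An $\mathcal O$-operator of $(A,\cdot,\alpha)$ with respect to $(V,\ell,r,\beta)$ is a linear $T:V\to A$ with $T\circ\beta=\alpha\circ T$ and $T(a)\cdot T(b)=T(\ell(T(a))b+r(T(b))a)$. Given such $T$, the products $a\blacktriangleright b=r(T(b))a$, $a\blacktriangleleft b=\ell(T(a))b$ make $V$ (with $\beta$) into the associated Hom-M-dendriform algebra. *)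

(* Defs.v *)
From HB Require Import structures.
From mathcomp Require Import all_boot all_order all_algebra.

Set Implicit Arguments.
Unset Strict Implicit.
Unset Printing Implicit Defensive.

Import GRing.Theory.
Local Open Scope ring_scope.

Definition bilin (K : fieldType) (U V W : lmodType K) (f : U -> V -> W) : Prop :=
  bilinear_for *:%R *:%R f.

Definition multiplicative_twist (K : fieldType) (A : lmodType K)
    (mul : A -> A -> A) (alpha : {linear A -> A}) : Prop :=
  forall x y, alpha (mul x y) = mul (alpha x) (alpha y).

Definition opsum (K : fieldType) (U V W : lmodType K)
  (f g : U -> V -> W) : U -> V -> W := fun x y => f x y + g x y.

Definition opdiff (K : fieldType) (U V W : lmodType K)
  (f g : U -> V -> W) : U -> V -> W := fun x y => f x y - g x y.

Definition hom_as (K : fieldType) (A : lmodType K)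
    (mul : A -> A -> A) (alpha : {linear A -> A}) (x y z : A) : A :=
  mul (mul x y) (alpha z) - mul (alpha x) (mul y z).

Record hom_alternative (K : fieldType) (A : lmodType K)
    (mul : A -> A -> A) (alpha : {linear A -> A}) : Prop := HomAlternative {
  halt_bilin : bilin mul;
  halt_mult : multiplicative_twist mul alpha;
  halt_left : forall x y, hom_as mul alpha x x y = 0;
  halt_right : forall x y, hom_as mul alpha y x x = 0
}.

Record rota_baxter0 (K : fieldType) (A : lmodType K)
    (mul : A -> A -> A) (alpha RB : {linear A -> A}) : Prop := RotaBaxter0 {
  rb_twist : forall x, RB (alpha x) = alpha (RB x);
  rb_eq : forall x y, mul (RB x) (RB y) = RB (mul (RB x) y + mul x (RB y))
}.

Record hom_pre_alternative (K : fieldType) (A : lmodType K)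
    (prec succ : A -> A -> A) (alpha : {linear A -> A}) : Prop :=
  HomPreAlternative {
  hpa_bilin_prec : bilin prec;
  hpa_bilin_succ : bilin succ;
  hpa_mult_prec : multiplicative_twist prec alpha;
  hpa_mult_succ : multiplicative_twist succ alpha;
  hpa1 : forall x y z,
    prec (succ x y) (alpha z) - succ (alpha x) (prec y z)
    + prec (prec y x) (alpha z) - prec (alpha y) (opsum prec succ x z) = 0;
  hpa2 : forall x y z,
    prec (succ x y) (alpha z) - succ (alpha x) (prec y z)
    + succ (opsum prec succ x z) (alpha y) - succ (alpha x) (succ z y) = 0;
  hpa3 : forall x y z,
    succ (opsum prec succ x y) (alpha z) - succ (alpha x) (succ y z)
    + succ (opsum prec succ y x) (alpha z) - succ (alpha y) (succ x z) = 0;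
  hpa4 : forall x y z,
    prec (prec x y) (alpha z) - prec (alpha x) (opsum prec succ y z)
    + prec (prec x z) (alpha y) - prec (alpha x) (opsum prec succ z y) = 0
}.

(* A linear map F : A -> End(V) is encoded as a map F : A -> V -> V which is
   linear in each argument; identities in End(V) are stated pointwise. *)
Definition equivariant (K : fieldType) (A V : lmodType K)
    (alpha : {linear A -> A}) (beta : {linear V -> V}) (F : A -> V -> V) : Prop :=
  forall x v, beta (F x v) = F (alpha x) (beta v).

Record prealt_bimodule (K : fieldType) (A : lmodType K)
    (prec succ : A -> A -> A) (alpha : {linear A -> A}) (V : lmodType K)
    (Lp Rp Ls Rs : A -> V -> V) (beta : {linear V -> V}) : Prop :=
  PrealtBimodule {
  pab_bilin_Lp : bilin Lp;
  pab_bilin_Rp : bilin Rp;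
  pab_bilin_Ls : bilin Ls;
  pab_bilin_Rs : bilin Rs;
  pab_twist_Lp : equivariant alpha beta Lp;
  pab_twist_Rp : equivariant alpha beta Rp;
  pab_twist_Ls : equivariant alpha beta Ls;
  pab_twist_Rs : equivariant alpha beta Rs;
  pab1 : forall x y v,
    Ls (opsum prec succ x y + opsum prec succ y x) (beta v)
    = Ls (alpha x) (Ls y v) + Ls (alpha y) (Ls x v);
  pab2 : forall x y v,
    Rs (alpha y) (opsum Lp Ls x v + opsum Rp Rs x v)
    = Ls (alpha x) (Rs y v) + Rs (succ x y) (beta v);
  pab3 : forall x y v,
    Rp (alpha y) (Ls x v) + Rp (alpha y) (Rp x v)
    = Ls (alpha x) (Rp y v) + Rp (opsum prec succ x y) (beta v);
  pab4 : forall x y v,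
    Rp (alpha y) (Rs x v) + Rp (alpha y) (Lp x v)
    = Lp (alpha x) (opsum Rp Rs y v) + Rs (prec x y) (beta v);
  pab5 : forall x y v,
    Lp (prec y x) (beta v) + Lp (succ x y) (beta v)
    = Lp (alpha y) (opsum Lp Ls x v) + Ls (alpha x) (Lp y v);
  pab6 : forall x y v,
    Rp (alpha x) (Ls y v) + Ls (opsum prec succ y x) (beta v)
    = Ls (alpha y) (Rp x v) + Ls (alpha y) (Ls x v);
  pab7 : forall x y v,
    Rp (alpha x) (Rs y v) + Rs (alpha y) (opsum Rp Rs x v)
    = Rs (prec y x) (beta v) + Rs (succ x y) (beta v);
  pab8 : forall x y v,
    Lp (succ y x) (beta v) + Rs (alpha x) (opsum Lp Ls y v)
    = Ls (alpha y) (Lp x v) + Ls (alpha y) (Rs x v);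
  pab9 : forall x y v,
    Rp (alpha x) (Rp y v) + Rp (alpha y) (Rp x v)
    = Rp (opsum prec succ x y + opsum prec succ y x) (beta v);
  pab10 : forall x y v,
    Rp (alpha y) (Lp x v) + Lp (prec x y) (beta v)
    = Lp (alpha x) (opsum Rp Rs y v + opsum Lp Ls y v)
}.

Record prealt_O_operator (K : fieldType) (A : lmodType K)
    (prec succ : A -> A -> A) (alpha : {linear A -> A}) (V : lmodType K)
    (Lp Rp Ls Rs : A -> V -> V) (beta : {linear V -> V})
    (T : {linear V -> A}) : Prop := PrealtOOperator {
  pao_twist : forall a, T (beta a) = alpha (T a);
  pao_succ : forall a b, succ (T a) (T b) = T (Ls (T a) b + Rs (T b) a);
  pao_prec : forall a b, prec (T a) (T b) = T (Lp (T a) b + Rp (T b) a)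
}.

Definition comm_of (K : fieldType) (A : lmodType K) (dot : A -> A -> A) (x y : A) : A :=
  dot x y - dot y x.

Record hom_pre_malcev (K : fieldType) (A : lmodType K)
    (dot : A -> A -> A) (alpha : {linear A -> A}) : Prop := HomPreMalcev {
  hpm_bilin : bilin dot;
  hpm_mult : multiplicative_twist dot alpha;
  hpm_eq : forall x y z t,
    dot (comm_of dot (alpha y) (alpha z)) (alpha (dot x t))
    + dot (comm_of dot (comm_of dot x y) (alpha z)) (alpha (alpha t))
    + dot (alpha (alpha y)) (dot (comm_of dot x z) (alpha t))
    - dot (alpha (alpha x)) (dot (alpha y) (dot z t))
    + dot (alpha (alpha z)) (dot (alpha x) (dot y t)) = 0
}.

Record premalcev_bimodule (K : fieldType) (A : lmodType K)
    (dot : A -> A -> A) (alpha : {linear A -> A}) (V : lmodType K)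
    (l r : A -> V -> V) (beta : {linear V -> V}) : Prop := PremalcevBimodule {
  pmb_bilin_l : bilin l;
  pmb_bilin_r : bilin r;
  pmb1_l : equivariant alpha beta l;
  pmb1_r : equivariant alpha beta r;
  pmb2 : forall x y z v, let rho := opdiff l r in
    r (alpha (alpha x)) (rho (alpha y) (rho z v))
    - r (dot (alpha z) (dot y x)) (beta (beta v))
    + l (alpha (alpha y)) (r (dot z x) (beta v))
    + l (alpha (comm_of dot z y)) (r (alpha x) (beta v))
    - l (alpha (alpha z)) (r (alpha x) (rho y v)) = 0;
  pmb3 : forall x y z v, let rho := opdiff l r in
    l (alpha (alpha y)) (l (alpha z) (r x v))
    - r (alpha (alpha x)) (rho (alpha y) (rho z v))
    - l (alpha (alpha z)) (r (dot y x) (beta v))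
    - r (alpha (dot z x)) (rho (alpha y) (beta v))
    + r (dot (comm_of dot z y) (alpha x)) (beta (beta v)) = 0;
  pmb4 : forall x y z v, let rho := opdiff l r in
    r (dot (alpha y) (dot z x)) (beta (beta v))
    + r (alpha (alpha x)) (rho (comm_of dot y z) (beta v))
    - l (alpha (alpha y)) (l (alpha z) (r x v))
    + r (alpha (dot y x)) (rho (alpha z) (beta v))
    + l (alpha (alpha z)) (r (alpha x) (rho y v)) = 0;
  pmb5 : forall x y z v,
    l (comm_of dot (comm_of dot x y) (alpha z)) (beta (beta v))
    - l (alpha (alpha x)) (l (alpha y) (l z v))
    + l (alpha (alpha z)) (l (alpha x) (l y v))
    + l (alpha (comm_of dot y z)) (l (alpha x) (beta v))
    + l (alpha (alpha y)) (l (comm_of dot x z) (beta v)) = 0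
}.

Record premalcev_O_operator (K : fieldType) (A : lmodType K)
    (dot : A -> A -> A) (alpha : {linear A -> A}) (V : lmodType K)
    (l r : A -> V -> V) (beta : {linear V -> V})
    (T : {linear V -> A}) : Prop := PremalcevOOperator {
  pmo_twist : forall a, T (beta a) = alpha (T a);
  pmo_eq : forall a b, dot (T a) (T b) = T (l (T a) b + r (T b) a)
}.

Definition rb_prec (K : fieldType) (A : lmodType K)
  (mul : A -> A -> A) (RB : {linear A -> A}) (x y : A) : A := mul x (RB y).

Definition rb_succ (K : fieldType) (A : lmodType K)
  (mul : A -> A -> A) (RB : {linear A -> A}) (x y : A) : A := mul (RB x) y.

Definition prealt_dot (K : fieldType) (A : lmodType K)
  (prec succ : A -> A -> A) (x y : A) : A := succ x y - prec y x.

(* The two products of the Hom-M-dendriform algebra on V associated to a bimodule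
   (V, l, r, beta) and an O-operator T: the black right and left triangles. *)
Definition Mdend_right (K : fieldType) (A V : lmodType K)
  (r : A -> V -> V) (T : {linear V -> A}) (a b : V) : V := r (T b) a.

Definition Mdend_left (K : fieldType) (A V : lmodType K)
  (l : A -> V -> V) (T : {linear V -> A}) (a b : V) : V := l (T a) b.

(* Main.v *)
(* The commutator of a Hom-alternative algebra satisfies the Hom-Malcev identity:
   the Teichmueller identity gives J(x, y, [x, z]) = [J(x, y, z), x] for the
   Jacobian J = 6 as, and its polarization yields the Malcev identity. The
   statements about modules reduce to this one by split extensions. For a
   Hom-pre-alternative algebra A, the space A + A with product
   (x, u)(y, v) = (x * y, x > v + u < y) is Hom-alternative, and its Malcev identity
   at (x, 0), (y, 0), (z, 0), (0, t) is the Hom-pre-Malcev identity of A. A bimodule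
   V makes A + V Hom-pre-alternative, hence Hom-pre-Malcev, and putting the element
   of V in each of the four slots gives the bimodule axioms. *)
Require Import Defs.
From HB Require Import structures.
From mathcomp Require Import all_boot all_order all_algebra.

Set Implicit Arguments.
Unset Strict Implicit.
Unset Printing Implicit Defensive.

Import GRing.Theory.
Local Open Scope ring_scope.

(** * Deciding formal identities in abelian groups by reflection *)

Inductive zexpr : Type :=
  ZVar of nat | ZZero | ZAdd of zexpr & zexpr | ZOpp of zexpr
| ZMuln of zexpr & nat.

Fixpoint zeval (V : zmodType) (env : seq V) (e : zexpr) : V :=
  match e with
  | ZVar i => nth 0 env i
  | ZZero => 0
  | ZAdd e1 e2 => zeval env e1 + zeval env e2
  | ZOpp e1 => - zeval env e1
  | ZMuln e1 n => zeval env e1 *+ n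
  end.

Fixpoint zcoef (e : zexpr) (j : nat) : int :=
  match e with
  | ZVar i => (i == j)%:Z
  | ZZero => 0
  | ZAdd e1 e2 => zcoef e1 j + zcoef e2 j
  | ZOpp e1 => - zcoef e1 j
  | ZMuln e1 n => zcoef e1 j *+ n
  end.

Lemma zevalE (V : zmodType) (env : seq V) (e : zexpr) :
  zeval env e = \sum_(j < size env) nth 0 env j *~ zcoef e j.
Proof.
elim: e => [i||e1 IH1 e2 IH2|e IH|e IH n] /=.
(* An index beyond the environment evaluates to the default 0, and its coefficient at each listed
   atom is 0 too. *)
- have [lt_i|ge_i] := ltnP i (size env); last first.
    rewrite nth_default // big1 // => j _.
    by rewrite gtn_eqF ?mulr0z // (leq_trans _ ge_i).
  rewrite (bigD1 (Ordinal lt_i)) //= eqxx mulr1z big1 ?addr0 // => j.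
  by rewrite -val_eqE eq_sym /= => /negPf ->; rewrite mulr0z.
- by rewrite big1 // => j _; rewrite mulr0z.
- by rewrite IH1 IH2 -big_split; apply: eq_bigr => j _; rewrite mulrzDr.
- by rewrite IH -sumrN; apply: eq_bigr => j _; rewrite mulrNz.
- rewrite IH -sumrMnl; apply: eq_bigr => j _.
  by rewrite !pmulrn -mulrzA mulrzz.
Qed.

Lemma zeval_eq (V : zmodType) (env : seq V) (e1 e2 : zexpr) :
  all (fun j => zcoef e1 j == zcoef e2 j) (iota 0 (size env)) ->
  zeval env e1 = zeval env e2.
Proof.
move=> /allP eq12; rewrite !zevalE; apply: eq_bigr => j _.
by rewrite (eqP (eq12 j _)) // mem_iota /=.
Qed.

Ltac zmem x env :=
  lazymatch env with
  | nil => constr:(false)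
  | x :: _ => constr:(true)
  | _ :: ?env' => zmem x env'
  end.

Ltac zindex x env :=
  lazymatch env with
  | x :: _ => constr:(0%N)
  | _ :: ?env' => let i := zindex x env' in constr:(S i)
  end.

Ltac zatoms env t :=
  lazymatch t with
  | @GRing.zero _ => env
  | (?x + ?y)%R => let env1 := zatoms env x in zatoms env1 y
  | (- ?x)%R => zatoms env x
  | (?x *+ _)%R => zatoms env x
  | _ => let b := zmem t env in
         lazymatch b with
         | true => env
         | false => constr:(t :: env)
         end
  end.

Ltac zquote env t :=
  lazymatch t with
  | @GRing.zero _ => constr:(ZZero)
  | (?x + ?y)%R =>
      let ex := zquote env x in let ey := zquote env y in constr:(ZAdd ex ey)
  | (- ?x)%R => let ex := zquote env x in constr:(ZOpp ex)
  | (?x *+ ?n)%R => let ex := zquote env x in constr:(ZMuln ex n)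
  | _ => let i := zindex t env in constr:(ZVar i)
  end.

(** Proves what holds in the free abelian group on the atoms. Atoms are compared syntactically, so
    products have to be expanded and brought to a common form beforehand. *)
Ltac zmodule :=
  lazymatch goal with
  | |- @eq ?V ?a ?b =>
      let env0 := zatoms (@nil V) a in
      let env := zatoms env0 b in
      let ea := zquote env a in
      let eb := zquote env b in
      apply: (@zeval_eq _ env ea eb); vm_compute; reflexivity
  end.

(** With [a = b] a sum of known identities, formed by [congr2 +%R], the remaining equation is a
    formal one for [zmodule]. *)
Lemma subr_trans_eq (V : zmodType) (a b c d : V) :
  a = b -> c - d = a - b -> c = d.
Proof. by move=> ->; rewrite subrr => /subr0_eq. Qed.

Lemma lmod_double_eq0 (K : fieldType) (V : lmodType K) (v : V) :
  2%:R != 0 :> K -> v *+ 2 = 0 -> v = 0.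
Proof.
by move=> nz2 /eqP; rewrite -scaler_nat scaler_eq0 (negPf nz2) => /eqP.
Qed.

(* Unlike [linearD] and its siblings, these never match the linear map [-%R]. *)
Section Linear.
Context (K : fieldType) (U V : lmodType K) (f : {linear U -> V}).

Lemma linear_funD x y : f (x + y) = f x + f y. Proof. exact: linearD. Qed.
Lemma linear_funN x : f (- x) = - f x. Proof. exact: linearN. Qed.
Lemma linear_fun0 : f 0 = 0. Proof. exact: linear0. Qed.

Definition linear_funE := (linear_funD, linear_funN, linear_fun0).

End Linear.

(** * Additivity of bilinear maps *)

Section Bilinear.
Context (K : fieldType) (U V W : lmodType K) (f : U -> V -> W).
Context (fB : bilin f).

Lemma bilinDl x y z : f (x + y) z = f x z + f y z.
Proof. by have := fB.1 z 1 x y; rewrite /= !scale1r. Qed.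

Lemma bilinDr x y z : f x (y + z) = f x y + f x z.
Proof. by have := fB.2 x 1 y z; rewrite /= !scale1r. Qed.

Lemma bilin0l z : f 0 z = 0.
Proof. by apply: (addrI (f 0 z)); rewrite -bilinDl !addr0. Qed.

Lemma bilin0r x : f x 0 = 0.
Proof. by apply: (addrI (f x 0)); rewrite -bilinDr !addr0. Qed.

Lemma bilinNl x z : f (- x) z = - f x z.
Proof. by apply/eqP; rewrite -addr_eq0 -bilinDl addNr bilin0l. Qed.

Lemma bilinNr x z : f x (- z) = - f x z.
Proof. by apply/eqP; rewrite -addr_eq0 -bilinDr addNr bilin0r. Qed.

Definition bilinE := (bilinDl, bilinDr, bilinNl, bilinNr, bilin0l, bilin0r).

End Bilinear.

Lemma bilin_opsum (K : fieldType) (U V W : lmodType K) (f g : U -> V -> W) :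
  bilin f -> bilin g -> bilin (opsum f g).
Proof.
move=> fB gB; split=> w k x y; rewrite /opsum /= ?(fB.1, gB.1) ?(fB.2, gB.2) /=.
  by rewrite scalerDr addrACA.
by rewrite scalerDr addrACA.
Qed.

Lemma bilin_opdiff (K : fieldType) (U V W : lmodType K) (f g : U -> V -> W) :
  bilin f -> bilin g -> bilin (opdiff f g).
Proof.
move=> fB gB; split=> w k x y; rewrite /opdiff /= ?(fB.1, gB.1) ?(fB.2, gB.2) /=.
  by rewrite scalerBr opprD addrACA.
by rewrite scalerBr opprD addrACA.
Qed.

Lemma bilin_swap (K : fieldType) (U V W : lmodType K) (f : U -> V -> W) :
  bilin f -> bilin (fun v u => f u v).
Proof. by move=> fB; split=> w k x y; rewrite /= ?(fB.1, fB.2). Qed.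

Lemma bilin_comm_of (K : fieldType) (A : lmodType K) (mul : A -> A -> A) :
  bilin mul -> bilin (comm_of mul).
Proof. by move=> mulB; exact: bilin_opdiff mulB (bilin_swap mulB). Qed.

(** * The Hom-Malcev identity from Sagle's identity *)

Definition hom_jacobian (K : fieldType) (A : lmodType K)
    (br : A -> A -> A) (alpha : {linear A -> A}) (x y z : A) : A :=
  br (br x y) (alpha z) + br (br y z) (alpha x) + br (br z x) (alpha y).

(** The left side of the Hom-pre-Malcev identity with every product and commutator replaced by the
    bracket. *)
Definition hom_malcev_expr (K : fieldType) (A : lmodType K)
    (br : A -> A -> A) (alpha : {linear A -> A}) (x y z t : A) : A :=
  br (br (alpha y) (alpha z)) (alpha (br x t))
  + br (br (br x y) (alpha z)) (alpha (alpha t))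
  + br (alpha (alpha y)) (br (br x z) (alpha t))
  - br (alpha (alpha x)) (br (alpha y) (br z t))
  + br (alpha (alpha z)) (br (alpha x) (br y t)).

(* The last hypothesis polarizes Sagle's identity J(x, y, [x, z]) = [J(x, y, z), x]
   in x; three instances of it add up to twice the conclusion. *)
Lemma hom_sagle_malcev (K : fieldType) (A : lmodType K)
    (br : A -> A -> A) (alpha : {linear A -> A}) :
  2%:R != 0 :> K -> bilin br -> (forall u v, br u v = - br v u) ->
  multiplicative_twist br alpha ->
  (forall x t y z,
    hom_jacobian br alpha (alpha x) (alpha y) (br t z)
    + hom_jacobian br alpha (alpha t) (alpha y) (br x z)
    = br (hom_jacobian br alpha x y z) (alpha (alpha t))
      + br (hom_jacobian br alpha t y z) (alpha (alpha x))) ->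
  forall x y z t, hom_malcev_expr br alpha x y z t = 0.
Proof.
move=> nz2 brB brC alphaM sagle x y z t; apply: (lmod_double_eq0 nz2).
apply: (subr_trans_eq (congr2 +%R (congr2 +%R
  (sagle t z y x) (sagle x z t y)) (esym (sagle y z x t)))).
(* Plain skew-symmetry would loop as a rewrite rule; this instance only moves a twisted factor to
   the right of a bracket. *)
have br_alpha_r u v w : br (alpha u) (br v w) = - br (br v w) (alpha u).
  exact: brC.
rewrite /hom_malcev_expr /hom_jacobian.
(* Normalization: inner brackets are sorted in the order x, y, z, t, then each product of two
   brackets gets one fixed orientation. *)
rewrite !(alphaM, bilinDl brB, br_alpha_r).
rewrite ?(brC t x, brC t y, brC t z, brC y x, brC z x, brC z y).
rewrite ?(brC (alpha t) (alpha x), brC (alpha t) (alpha y)).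
rewrite ?(brC (alpha t) (alpha z), brC (alpha y) (alpha x)).
rewrite ?(brC (alpha z) (alpha x), brC (alpha z) (alpha y)).
rewrite !(bilinNl brB, bilinNr brB).
rewrite ?(brC (br (alpha y) (alpha z)) (br (alpha x) (alpha t))).
rewrite ?(brC (br (alpha y) (alpha t)) (br (alpha x) (alpha z))).
rewrite ?(brC (br (alpha z) (alpha t)) (br (alpha x) (alpha y))).
by zmodule.
Qed.

(** * Associators and commutators in Hom-alternative algebras *)

Section HomAlternative.
Context (K : fieldType) (A : lmodType K).
Context (mul : A -> A -> A) (alpha : {linear A -> A}).
Context (HA : hom_alternative mul alpha).

Local Infix "**" := mul (at level 40, left associativity).
Local Notation asc := (hom_as mul alpha).
Local Notation br := (comm_of mul).

Let alphaE := linear_funE alpha.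
Let mulE := bilinE (halt_bilin HA).

(** Linearizes left alternativity at [x + y]; the two diagonal associators are added as zeros. *)
Lemma hom_as_skew12 x y z : asc y x z = - asc x y z.
Proof.
apply/eqP; rewrite -addr_eq0; apply/eqP.
apply: (subr_trans_eq (halt_left HA (x + y) z)); rewrite !subr0.
move: (halt_left HA x z) (halt_left HA y z); rewrite /hom_as => X Y.
rewrite -[LHS]addr0 -[in LHS]X -[LHS]addr0 -[in LHS]Y !alphaE !mulE.
by zmodule.
Qed.

Lemma hom_as_skew23 x y z : asc x z y = - asc x y z.
Proof.
apply/eqP; rewrite -addr_eq0; apply/eqP.
apply: (subr_trans_eq (halt_right HA (y + z) x)); rewrite !subr0.
move: (halt_right HA y x) (halt_right HA z x); rewrite /hom_as => X Y.
rewrite -[LHS]addr0 -[in LHS]X -[LHS]addr0 -[in LHS]Y !alphaE !mulE.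
by zmodule.
Qed.

Lemma hom_as_cycle x y z : asc x y z = asc y z x.
Proof. by rewrite hom_as_skew12 hom_as_skew23 opprK. Qed.

(* The Teichmueller identity, with the product cycled to the last slot of each
   associator. *)
Lemma hom_as_teichmuller w x y z :
  asc (alpha y) (alpha z) (w ** x) - asc (alpha z) (alpha w) (x ** y)
    + asc (alpha w) (alpha x) (y ** z)
  = alpha (alpha w) ** asc x y z + asc w x y ** alpha (alpha z).
Proof.
(* Rotating back puts the products in slots one, two and three; the identity is then a formal
   expansion using multiplicativity. *)
rewrite -(hom_as_cycle (w ** x)) (hom_as_cycle (alpha z)).
rewrite /hom_as !(halt_mult HA) !mulE.
by zmodule.
Qed.

Lemma hom_as_comm x t y z :
  asc (alpha x) (alpha y) (br t z) + asc (alpha t) (alpha y) (br x z)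
  = br (asc x y z) (alpha (alpha t)) + br (asc t y z) (alpha (alpha x)).
Proof.
(* The instances form pairs exchanged by x and t. In the sum, associators containing a product of x
   with t or of y with z cancel by skew-symmetry, as do the outer products by y. *)
have H := (congr2 +%R
  (congr2 +%R (hom_as_teichmuller t x z y) (hom_as_teichmuller y z x t))
  (congr2 +%R (hom_as_teichmuller x t z y) (hom_as_teichmuller y z t x))).
apply: subr_trans_eq H _.
have asB u v a b : asc u v (a - b) = asc u v a - asc u v b.
  by rewrite /hom_as !alphaE !mulE; zmodule.
rewrite /comm_of !asB.
rewrite !(hom_as_skew12 (alpha y) (alpha z)) !(hom_as_skew12 (alpha x) (alpha t)).
rewrite !(hom_as_skew12 (alpha x) (alpha y)) !(hom_as_skew12 (alpha t) (alpha y)).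
rewrite (hom_as_skew23 x y z) (hom_as_skew23 t y z).
rewrite -(hom_as_cycle x y z) -(hom_as_cycle t y z).
rewrite (hom_as_cycle z x t) (hom_as_cycle z t x) (hom_as_skew12 x t z).
by rewrite !mulE; zmodule.
Qed.

Local Notation J := (hom_jacobian br alpha).

(** The Jacobian is the signed sum of the associators over all six permutations, and skew-symmetry
    makes these terms equal. *)
Lemma hom_jacobianE x y z : J x y z = asc x y z *+ 6.
Proof.
have -> : J x y z = asc x y z + asc y z x + asc z x y
                    - asc y x z - asc z y x - asc x z y.
  by rewrite /hom_jacobian /comm_of /hom_as !mulE; zmodule.
rewrite (hom_as_cycle z x y) -(hom_as_cycle x y z) (hom_as_cycle z y x).
by rewrite (hom_as_skew12 x y z) (hom_as_skew23 x y z); zmodule.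
Qed.

Lemma hom_jacobian_comm x t y z :
  J (alpha x) (alpha y) (br t z) + J (alpha t) (alpha y) (br x z)
  = br (J x y z) (alpha (alpha t)) + br (J t y z) (alpha (alpha x)).
Proof.
rewrite !hom_jacobianE -mulrnDl hom_as_comm mulrnDl.
have br6 u v : br (u *+ 6) v = br u v *+ 6.
  by rewrite [u *+ 6]mulrS !mulrS mulr0n /comm_of !mulE; zmodule.
by rewrite !br6.
Qed.

Lemma hom_alternative_malcev x y z t : 2%:R != 0 :> K ->
  hom_malcev_expr br alpha x y z t = 0.
Proof.
move=> nz2; apply: hom_sagle_malcev => //.
- exact: bilin_comm_of (halt_bilin HA).
- by move=> u v; rewrite /comm_of opprB.
- by move=> u v; rewrite /comm_of !alphaE !(halt_mult HA).
- exact: hom_jacobian_comm.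
Qed.

End HomAlternative.

(** On the diagonal, skew-symmetry says that twice the associator vanishes. The pre-alternative
    axioms deliver this linearized form. *)
Lemma hom_alternative_skew (K : fieldType) (A : lmodType K)
    (mul : A -> A -> A) (alpha : {linear A -> A}) :
  2%:R != 0 :> K -> bilin mul -> multiplicative_twist mul alpha ->
  (forall x y z, hom_as mul alpha x y z + hom_as mul alpha y x z = 0) ->
  (forall x y z, hom_as mul alpha x y z + hom_as mul alpha x z y = 0) ->
  hom_alternative mul alpha.
Proof.
move=> nz2 mulB mulM skew12 skew23; split=> // x y;
  apply: (lmod_double_eq0 nz2); rewrite mulr2n //.
Qed.

(** * Split extensions of an algebra by a module *)

Section SplitExtension.
Context (K : fieldType) (A V : lmodType K).
Context (alpha : {linear A -> A}) (beta : {linear V -> V}).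

Definition pair_map (p : A * V) : A * V := (alpha p.1, beta p.2).

Fact pair_map_linear : linear pair_map.
Proof. by move=> k p q; rewrite /pair_map /= !linearP. Qed.

HB.instance Definition _ :=
  GRing.isLinear.Build K (A * V)%type (A * V)%type *:%R pair_map pair_map_linear.

Definition pair_lin : {linear (A * V)%type -> (A * V)%type} := pair_map.

(** The semidirect product in which V has square zero; [r] is the right action, with the algebra
    element written first. *)
Definition split_mul (m : A -> A -> A) (l r : A -> V -> V) (p q : A * V) : A * V :=
  (m p.1 q.1, l p.1 q.2 + r q.1 p.2).

Lemma bilin_split_mul m l r :
  bilin m -> bilin l -> bilin r -> bilin (split_mul m l r).
Proof.
move=> mB lB rB; split=> q k x y; rewrite /split_mul /=; congr pair;
  rewrite ?(mB.1, mB.2) ?(lB.1, lB.2) ?(rB.1, rB.2) //=.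
  by rewrite scalerDr addrACA.
by rewrite scalerDr addrACA.
Qed.

Lemma split_mul_multiplicative m l r :
  multiplicative_twist m alpha -> equivariant alpha beta l ->
  equivariant alpha beta r -> multiplicative_twist (split_mul m l r) pair_lin.
Proof.
move=> mM lE rE x y; rewrite /split_mul /=.
by rewrite -mM -lE -rE -linearD.
Qed.

Definition split_inl (x : A) : A * V := (x, 0).
Definition split_inr (v : V) : A * V := (0, v).

Lemma split_inr_eq0 v : split_inr v = 0 -> v = 0.
Proof. by move/(congr1 snd). Qed.

Lemma split_inrD u v : split_inr u + split_inr v = split_inr (u + v).
Proof. by congr pair; rewrite /= addr0. Qed.

Lemma split_inrN v : - split_inr v = split_inr (- v).
Proof. by congr pair; rewrite /= oppr0. Qed.

Lemma pair_lin_inl x : pair_lin (split_inl x) = split_inl (alpha x).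
Proof. by congr pair; rewrite /= linear0. Qed.

Lemma pair_lin_inr v : pair_lin (split_inr v) = split_inr (beta v).
Proof. by congr pair; rewrite /= linear0. Qed.

Context (m : A -> A -> A) (l r : A -> V -> V).
Context (mB : bilin m) (lB : bilin l) (rB : bilin r).

Lemma split_mul_ll x y :
  split_mul m l r (split_inl x) (split_inl y) = split_inl (m x y).
Proof. by congr pair; rewrite /= (bilin0r lB) (bilin0r rB) addr0. Qed.

Lemma split_mul_lr x v :
  split_mul m l r (split_inl x) (split_inr v) = split_inr (l x v).
Proof. by congr pair; rewrite /= ?(bilin0r mB) ?(bilin0l rB) ?addr0. Qed.

Lemma split_mul_rl x v :
  split_mul m l r (split_inr v) (split_inl x) = split_inr (r x v).
Proof. by congr pair; rewrite /= ?(bilin0l mB) ?(bilin0l lB) ?add0r. Qed.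

Lemma split_comm_ll x y :
  comm_of (split_mul m l r) (split_inl x) (split_inl y) = split_inl (comm_of m x y).
Proof. by rewrite /comm_of !split_mul_ll; congr pair; rewrite /= subr0. Qed.

(** The source of [rho] in the bimodule axioms. *)
Lemma split_comm_lr x v :
  comm_of (split_mul m l r) (split_inl x) (split_inr v)
  = split_inr (opdiff l r x v).
Proof. by rewrite /comm_of split_mul_lr split_mul_rl split_inrN split_inrD. Qed.

Lemma split_comm_rl x v :
  comm_of (split_mul m l r) (split_inr v) (split_inl x)
  = split_inr (- opdiff l r x v).
Proof.
by rewrite /comm_of split_mul_lr split_mul_rl split_inrN split_inrD opprB.
Qed.

(** Two factors in V need no rule: the identities are evaluated with exactly one argument in V. *)
Definition splitE := (split_comm_ll, split_comm_lr, split_comm_rl, split_mul_ll,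
  split_mul_lr, split_mul_rl, pair_lin_inl, pair_lin_inr, split_inrN, split_inrD).

End SplitExtension.

(** * From Hom-pre-alternative to Hom-pre-Malcev algebras *)

Section PreAlternative.
Context (K : fieldType) (A : lmodType K).
Context (prec succ : A -> A -> A) (alpha : {linear A -> A}).
Context (HP : hom_pre_alternative prec succ alpha).

Let precE := bilinE (hpa_bilin_prec HP).
Let succE := bilinE (hpa_bilin_succ HP).

(* The alternative algebra (A, prec + succ) acts on A by succ on the left and
   prec on the right; this is the split extension by that bimodule. *)
Lemma hom_pre_alternative_split : 2%:R != 0 :> K ->
  hom_alternative
    (split_mul (opsum prec succ) succ (fun x u => prec u x)) (pair_lin alpha alpha).
Proof.
have precB := hpa_bilin_prec HP; have succB := hpa_bilin_succ HP.
move=> nz2; apply: (hom_alternative_skew nz2).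
- by apply: bilin_split_mul => //; [exact: bilin_opsum | exact: bilin_swap].
- apply: split_mul_multiplicative => [x y|x y|x y].
  + by rewrite /opsum linearD (hpa_mult_prec HP) (hpa_mult_succ HP).
  + exact: hpa_mult_succ HP _ _.
  + exact: hpa_mult_prec HP _ _.
(* The second component is a sum of parts linear in u, v and w, one axiom for each; the first
   component is the same sum at u = x, v = y, w = z. *)
- move=> [x u] [y v] [z w]; rewrite /hom_as /split_mul; congr pair => /=.
    apply: (subr_trans_eq (congr2 +%R (hpa1 HP x y z)
      (congr2 +%R (hpa1 HP y x z) (hpa3 HP x y z)))).
    by rewrite /opsum !precE !succE; zmodule.
  apply: (subr_trans_eq (congr2 +%R (hpa1 HP x v z)
    (congr2 +%R (hpa1 HP y u z) (hpa3 HP x y w)))).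
  by rewrite /opsum !precE !succE; zmodule.
- move=> [x u] [y v] [z w]; rewrite /hom_as /split_mul; congr pair => /=.
    apply: (subr_trans_eq (congr2 +%R (hpa2 HP x y z)
      (congr2 +%R (hpa2 HP x z y) (hpa4 HP x y z)))).
    by rewrite /opsum !precE !succE; zmodule.
  apply: (subr_trans_eq (congr2 +%R (hpa2 HP x v z)
    (congr2 +%R (hpa2 HP x w y) (hpa4 HP u y z)))).
  by rewrite /opsum !precE !succE; zmodule.
Qed.

Lemma hom_pre_alternative_pre_malcev : 2%:R != 0 :> K ->
  hom_pre_malcev (prealt_dot prec succ) alpha.
Proof.
move=> nz2; split.
- exact: bilin_opdiff (hpa_bilin_succ HP) (bilin_swap (hpa_bilin_prec HP)).
- by move=> x y; rewrite /prealt_dot linearB (hpa_mult_prec HP) (hpa_mult_succ HP).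
move=> x y z t.
have starB : bilin (opsum prec succ).
  exact: bilin_opsum (hpa_bilin_prec HP) (hpa_bilin_succ HP).
have := hom_alternative_malcev (hom_pre_alternative_split nz2)
  (split_inl A x) (split_inl A y) (split_inl A z) (split_inr A t) nz2.
rewrite /hom_malcev_expr.
rewrite !(splitE _ _ starB (hpa_bilin_succ HP) (bilin_swap (hpa_bilin_prec HP))).
(* The commutators of the two products agree, and [rho] for this extension is [prealt_dot] by
   conversion. *)
have dot_comm a b : comm_of (opsum prec succ) a b = comm_of (prealt_dot prec succ) a b.
  by rewrite /comm_of /opsum /prealt_dot; zmodule.
by rewrite !dot_comm => /split_inr_eq0.
Qed.
End PreAlternative.

(** [RB] maps the sum of the two products to the product of the images, so each axiom is a
    skew-symmetry of the associator with [RB] applied to two of its arguments. *)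
Lemma hom_alternative_pre_alternative (K : fieldType) (A : lmodType K)
    (mul : A -> A -> A) (alpha RB : {linear A -> A}) :
  hom_alternative mul alpha -> rota_baxter0 mul alpha RB ->
  hom_pre_alternative (rb_prec mul RB) (rb_succ mul RB) alpha.
Proof.
move=> HA HRB; have mulB := halt_bilin HA.
have skew12 x y z : hom_as mul alpha x y z + hom_as mul alpha y x z = 0.
  by rewrite (hom_as_skew12 HA x y z) addrN.
have skew23 x y z : hom_as mul alpha x y z + hom_as mul alpha x z y = 0.
  by rewrite (hom_as_skew23 HA x y z) addrN.
have RBmul x y : RB (opsum (rb_prec mul RB) (rb_succ mul RB) x y) = mul (RB x) (RB y).
  by rewrite (rb_eq HRB) addrC.
split.
- by split=> w k x y; rewrite /rb_prec /= ?linearP ?(mulB.1, mulB.2).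
- by split=> w k x y; rewrite /rb_succ /= ?linearP ?(mulB.1, mulB.2).
- by move=> x y; rewrite /rb_prec (halt_mult HA) (rb_twist HRB).
- by move=> x y; rewrite /rb_succ (halt_mult HA) (rb_twist HRB).
- move=> x y z; apply: (subr_trans_eq (skew12 (RB x) y (RB z))).
  by rewrite /rb_prec /rb_succ RBmul /hom_as !(rb_twist HRB); zmodule.
- move=> x y z; apply: (subr_trans_eq (skew23 (RB x) y (RB z))).
  by rewrite /rb_prec /rb_succ RBmul /hom_as !(rb_twist HRB); zmodule.
- move=> x y z; apply: (subr_trans_eq (skew12 (RB x) (RB y) z)).
  by rewrite /rb_prec /rb_succ !RBmul /hom_as !(rb_twist HRB); zmodule.
- move=> x y z; apply: (subr_trans_eq (skew23 x (RB y) (RB z))).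
  by rewrite /rb_prec /rb_succ !RBmul /hom_as !(rb_twist HRB); zmodule.
Qed.

(** * Bimodules and O-operators *)

Section PrealtBimodule.
Context (K : fieldType) (A : lmodType K).
Context (prec succ : A -> A -> A) (alpha : {linear A -> A}).
Context (HP : hom_pre_alternative prec succ alpha).
Context (V : lmodType K) (Lp Rp Ls Rs : A -> V -> V) (beta : {linear V -> V}).
Context (HV : prealt_bimodule prec succ alpha Lp Rp Ls Rs beta).

Let LpE := bilinE (pab_bilin_Lp HV).
Let RpE := bilinE (pab_bilin_Rp HV).
Let LsE := bilinE (pab_bilin_Ls HV).
Let RsE := bilinE (pab_bilin_Rs HV).
Let actE := (LpE, RpE, LsE, RsE).

(** The module part of each axiom splits by the slot holding the element of V, one bimodule identity
    per slot. The last two axioms are symmetric in two slots, where one identity serves twice. *)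
Lemma prealt_bimodule_split :
  hom_pre_alternative (split_mul prec Lp Rp) (split_mul succ Ls Rs)
    (pair_lin alpha beta).
Proof.
split.
- apply: bilin_split_mul; [exact: hpa_bilin_prec HP | exact: pab_bilin_Lp HV
    | exact: pab_bilin_Rp HV].
- apply: bilin_split_mul; [exact: hpa_bilin_succ HP | exact: pab_bilin_Ls HV
    | exact: pab_bilin_Rs HV].
- apply: split_mul_multiplicative; [exact: hpa_mult_prec HP
    | exact: pab_twist_Lp HV | exact: pab_twist_Rp HV].
- apply: split_mul_multiplicative; [exact: hpa_mult_succ HP
    | exact: pab_twist_Ls HV | exact: pab_twist_Rs HV].
- move=> [x u] [y v] [z w]; rewrite /split_mul /opsum.
  congr pair => /=; first exact: (hpa1 HP).
  apply: (subr_trans_eq (congr2 +%R (pab4 HV y z u)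
    (congr2 +%R (pab3 HV x z v) (pab5 HV x y w)))).
  by rewrite /opsum !actE; zmodule.
- move=> [x u] [y v] [z w]; rewrite /split_mul /opsum.
  congr pair => /=; first exact: (hpa2 HP).
  apply: (subr_trans_eq (congr2 +%R (pab7 HV z y u)
    (congr2 +%R (pab6 HV z x v) (pab8 HV y x w)))).
  by rewrite /opsum !actE; zmodule.
- move=> [x u] [y v] [z w]; rewrite /split_mul /opsum.
  congr pair => /=; first exact: (hpa3 HP).
  apply: (subr_trans_eq (congr2 +%R (pab2 HV y z u)
    (congr2 +%R (pab2 HV x z v) (pab1 HV x y w)))).
  by rewrite /opsum !actE; zmodule.
- move=> [x u] [y v] [z w]; rewrite /split_mul /opsum.
  congr pair => /=; first exact: (hpa4 HP).
  apply: (subr_trans_eq (congr2 +%R (pab9 HV z y u)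
    (congr2 +%R (pab10 HV x z v) (pab10 HV x y w)))).
  by rewrite /opsum !actE; zmodule.
Qed.

Lemma prealt_bimodule_premalcev : 2%:R != 0 :> K ->
  premalcev_bimodule (prealt_dot prec succ) alpha (opdiff Ls Rp) (opdiff Rs Lp) beta.
Proof.
move=> nz2.
have [dotB alpha_dot _] := hom_pre_alternative_pre_malcev HP nz2.
have alpha_comm x y : alpha (comm_of (prealt_dot prec succ) x y)
    = comm_of (prealt_dot prec succ) (alpha x) (alpha y).
  by rewrite /comm_of linearB !alpha_dot.
have [_ _ malcev] := hom_pre_alternative_pre_malcev prealt_bimodule_split nz2.
have lB := bilin_opdiff (pab_bilin_Ls HV) (pab_bilin_Rp HV).
have rB := bilin_opdiff (pab_bilin_Rs HV) (pab_bilin_Lp HV).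
have rhoB := bilin_opdiff lB rB.
(* The pre-Malcev product of the extension is itself a split product, which dictates the actions
   [opdiff Ls Rp] and [opdiff Rs Lp]. *)
have dot_split : prealt_dot (split_mul prec Lp Rp) (split_mul succ Ls Rs)
    =2 split_mul (prealt_dot prec succ) (opdiff Ls Rp) (opdiff Rs Lp).
  move=> [x u] [y v]; rewrite /prealt_dot /split_mul /opdiff; congr pair => /=.
  by zmodule.
have dotE := splitE alpha beta dotB lB rB.
(* [dot_split] is pointwise and cannot rewrite the unapplied product inside [comm_of]. *)
have comm_split x y :
    comm_of (prealt_dot (split_mul prec Lp Rp) (split_mul succ Ls Rs)) x y
    = comm_of (split_mul (prealt_dot prec succ) (opdiff Ls Rp) (opdiff Rs Lp)) x y.
  by rewrite /comm_of !dot_split.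
have lE : equivariant alpha beta (opdiff Ls Rp).
  by move=> x v; rewrite /opdiff linearB (pab_twist_Ls HV) (pab_twist_Rp HV).
have rE : equivariant alpha beta (opdiff Rs Lp).
  by move=> x v; rewrite /opdiff linearB (pab_twist_Rs HV) (pab_twist_Lp HV).
split=> //.
(* The four remaining axioms put v in the first, second, third and fourth slot in turn. *)
- move=> x y z v rho.
  have := malcev (split_inr A v) (split_inl V z) (split_inl V y) (split_inl V x).
  rewrite !comm_split !dot_split !dotE => /split_inr_eq0/subr_trans_eq; apply.
  rewrite /rho ?(lE, rE) ?alpha_comm ?alpha_dot.
  by rewrite ?(bilinNr rhoB) ?(bilinNr lB, bilinNr rB); zmodule.
- move=> x y z v rho.
  have := malcev (split_inl V z) (split_inr A v) (split_inl V y) (split_inl V x).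
  rewrite !comm_split !dot_split !dotE => /split_inr_eq0/subr_trans_eq; apply.
  rewrite /rho ?(lE, rE) ?alpha_comm ?alpha_dot.
  by rewrite ?(bilinNr rhoB) ?(bilinNr lB, bilinNr rB); zmodule.
- move=> x y z v rho.
  have := malcev (split_inl V y) (split_inl V z) (split_inr A v) (split_inl V x).
  rewrite !comm_split !dot_split !dotE => /split_inr_eq0/subr_trans_eq; apply.
  rewrite /rho ?(lE, rE) ?alpha_comm ?alpha_dot.
  by rewrite ?(bilinNr rhoB) ?(bilinNr lB, bilinNr rB); zmodule.
- move=> x y z v.
  have := malcev (split_inl V x) (split_inl V y) (split_inl V z) (split_inr A v).
  rewrite !comm_split !dot_split !dotE => /split_inr_eq0/subr_trans_eq; apply.
  by rewrite !lE ?alpha_comm; zmodule.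
Qed.

End PrealtBimodule.

(** Subtract the [prec] equation at (b, a) from the [succ] equation at (a, b) and regroup. *)
Lemma prealt_O_operator_premalcev (K : fieldType) (A : lmodType K)
    (prec succ : A -> A -> A) (alpha : {linear A -> A}) (V : lmodType K)
    (Lp Rp Ls Rs : A -> V -> V) (beta : {linear V -> V}) (T : {linear V -> A}) :
  prealt_O_operator prec succ alpha Lp Rp Ls Rs beta T ->
  premalcev_O_operator (prealt_dot prec succ) alpha
    (opdiff Ls Rp) (opdiff Rs Lp) beta T.
Proof.
move=> HT; split=> [a|a b]; first exact: pao_twist HT a.
rewrite /prealt_dot (pao_succ HT) (pao_prec HT) -linearB /opdiff; congr (T _).
by zmodule.
Qed.

Theorem theorem4p2 (K : fieldType) (charK : [pchar K] =i pred0)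
  (A : lmodType K) (mul : A -> A -> A) (alpha : {linear A -> A})
  (HA : hom_alternative mul alpha)
  (RB : {linear A -> A}) (HRB : rota_baxter0 mul alpha RB)
  (V : lmodType K) (Lp Rp Ls Rs : A -> V -> V) (beta : {linear V -> V})
  (HV : prealt_bimodule (rb_prec mul RB) (rb_succ mul RB) alpha Lp Rp Ls Rs beta)
  (T : {linear V -> A})
  (HT : prealt_O_operator (rb_prec mul RB) (rb_succ mul RB) alpha Lp Rp Ls Rs beta T) :
  let prec := rb_prec mul RB in
  let succ := rb_succ mul RB in
  let dot := prealt_dot prec succ in
  let l := opdiff Ls Rp in
  let r := opdiff Rs Lp in
  let blackright := Mdend_right r T in
  let blackleft := Mdend_left l T in
  let searrow := fun a b : V => Ls (T a) b in
  let nearrow := fun a b : V => Rs (T b) a in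
  let swarrow := fun a b : V => Lp (T a) b in
  let nwarrow := fun a b : V => Rp (T b) a in
  [/\ hom_pre_alternative prec succ alpha,
      hom_pre_malcev dot alpha,
      premalcev_bimodule dot alpha l r beta,
      premalcev_O_operator dot alpha l r beta T
    & forall a b : V,
        blackright a b = nearrow a b - swarrow b a /\
        blackleft a b = searrow a b - nwarrow b a].
Proof.
have nz2 : 2%:R != 0 :> K by rewrite ((pcharf0P K).1 charK).
have HP := hom_alternative_pre_alternative HA HRB.
(* The formulas for the triangles hold by conversion and are closed here. *)
split=> //.
- exact: hom_pre_alternative_pre_malcev.
- exact: prealt_bimodule_premalcev.
- exact: prealt_O_operator_premalcev.
Qed.
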